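(* Let $\Phi=(\varphi_n)_n$ and $\Psi=(\psi_n)_n$ be two frames for $\mathcal H$ and let $\Phi^{gd}=(\varphi_n^{gd})_n$ be a fixed g-dual frame of $\Phi$ with corresponding invertible operator $\mathcal A$. If $\Phi-\Psi$ is a Bessel sequence with sufficiently small bound $M_{\Phi-\Psi}$, then there exists a g-dual frame $\Psi^{gd}=(\psi_n^{gd})_n$ of $\Psi$ such that $\Phi^{gd}-\Psi^{gd}$ is also a Bessel sequence and its bound is a multiple of $M_{\Phi-\Psi}$. In particular, $T_\Phi U_{\Phi^{gd}}=\mathcal A^{-1}=T_\Psi U_{\Psi^{gd}}$.
   Context: $\mathcal H$ is a separable Hilbert space and $B(\mathcal H)$ is the set of bounded linear operators on $\mathcal H$. A sequence $\Phi=(\varphi_n)_{n\in\mathbb N}$ in $\mathcal H$ is a frame with frame bounds $m_\Phi,M_\Phi>0$ if $m_\Phi\|f\|^2\le\sum_{n}|\langle f,\varphi_n\rangle|^2\le M_\Phi\|f\|^2$ for all $f\in\mathcal H$; it is a Bessel sequence with (Bessel) bound $M_\Phi$ if only the second inequality is required. For a Bessel sequence $\Phi$, the analysis operator is $U_\Phi:\mathcal H\to\ell^2$, $U_\Phi f=(\langle f,\varphi_n\rangle)_n$, and the synthesis operator is $T_\Phi:\ell^2\to\mathcal H$, $T_\Phi((c_n)_n)=\sum_n c_n\varphi_n$. A frame $\Phi^{gd}=(\varphi_n^{gd})_n$ is a g-dual (generalized dual) frame of the frame $\Phi$ with corresponding invertible operator $\mathcal A\in B(\mathcal H)$ if $f=\sum_n\langle\mathcal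 A f,\varphi_n^{gd}\rangle\varphi_n$ for all $f\in\mathcal H$, i.e. $T_\Phi U_{\Phi^{gd}}=\mathcal A^{-1}$. The notation $\Phi-\Psi$ (resp. $\Phi^{gd}-\Psi^{gd}$) denotes the sequence $(\varphi_n-\psi_n)_n$ (resp. $(\varphi_n^{gd}-\psi_n^{gd})_n$). *)

(* Defs.v *)
From mathcomp Require Import all_boot all_order all_algebra.
From mathcomp Require Import sesquilinear complex.
From mathcomp Require Import all_classical all_reals all_analysis.

Set Implicit Arguments.
Unset Strict Implicit.
Unset Printing Implicit Defensive.

Import Order.TTheory GRing.Theory Num.Theory.
Import numFieldNormedType.Exports.

Local Open Scope classical_set_scope.
Local Open Scope ring_scope.

(* [scalar_field K conj]: K is the field of real or of complex numbers and
   conj is its conjugation. *)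
Inductive scalar_field : forall K : numFieldType, (K -> K) -> Prop :=
| scalar_real (R : realType) : @scalar_field R idfun
| scalar_complex (R : realType) : @scalar_field R[i] (@conjc R).

Definition separable_space (T : topologicalType) : Prop :=
  exists2 S : set T, countable S & dense S.

Section Operators.
Context {K : numFieldType} {H : normedModType K}.

Definition bounded_op (A : {linear H -> H}) : Prop :=
  exists c : K, forall f : H, `|A f| <= c * `|f|.

(* A and B are elements of B(H) that are inverse to each other. *)
Definition inverse_op (A B : {linear H -> H}) : Prop :=
  [/\ bounded_op A, bounded_op B, cancel A B & cancel B A].

Definition invertible_op (A : {linear H -> H}) : Prop :=
  exists B : {linear H -> H}, inverse_op A B.

End Operators.

(* The inner product [ip] is linear in its first argument. Norms, hence also
   frame bounds, take their values in K; when K is complex, [0 < m] and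
   [x <= y] force [m] and [y - x] to be real. *)
Section Frames.
Context {K : numFieldType} {conj : K -> K} {H : completeNormedModType K}.
Variable ip : {dot H for conj}.

(* With completeness of H, this makes (H, ip) a Hilbert space. *)
Definition norm_of_ip : Prop := forall f : H, `|f| ^+ 2 = ip f f.

(* U_Phi and T_Phi, written on all sequences; for a Bessel sequence Phi, U_Phi
   takes its values in l^2 and the series T_Phi c converges for c in l^2. *)
Definition analysis (Phi : nat -> H) (f : H) : nat -> K :=
  fun n => ip f (Phi n).

Definition synthesis (Phi : nat -> H) (c : nat -> K) : H :=
  limn (series (fun n => c n *: Phi n)).

Definition energy (Phi : nat -> H) (f : H) : nat -> K :=
  series (fun n => `|ip f (Phi n)| ^+ 2).

Definition bessel_bound (M : K) (Phi : nat -> H) : Prop :=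
  0 < M /\
  forall f : H, cvgn (energy Phi f) /\ limn (energy Phi f) <= M * `|f| ^+ 2.

Definition frame_bounds (m M : K) (Phi : nat -> H) : Prop :=
  [/\ 0 < m, bessel_bound M Phi &
      forall f : H, m * `|f| ^+ 2 <= limn (energy Phi f)].

Definition frame (Phi : nat -> H) : Prop :=
  exists m M : K, frame_bounds m M Phi.

(* Phigd is a g-dual frame of Phi with corresponding invertible operator A. *)
Definition gdual (Phi Phigd : nat -> H) (A : {linear H -> H}) : Prop :=
  [/\ frame Phigd, invertible_op A &
      forall f : H,
        series (fun n => ip (A f) (Phigd n) *: Phi n) @ \oo --> f].

End Frames.

(* Main.v *)
(* With [T = T_Psi U_Phigd], the operator [D = Ainv - T = T_(Phi - Psi) U_Phigd]
   satisfies [|D f|^2 <= M Mg |f|^2], so for small [M] the map [A D] is a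
   contraction and [h = f + A D h] has a solution [h = X f] for every [f]; then
   [T X = Ainv].  The g-dual must satisfy [<f, psigd_n> = <X f, phigd_n>], that
   is, [psigd_n = X^* phigd_n].  No Riesz representation is needed for [X^*]:
   [S = T_Phigd U_Psi] and [S0 = T_Phigd U_Phi] are the adjoints of [T] and
   [Ainv], and [S] is surjective because [T] is bounded below, so
   [psigd_n = S0 y_n] with [S y_n = phigd_n].  Finally [f - X f = - A D X f] makes
   the Bessel bound of [Phigd - Psigd] linear in [M]. *)
Require Import Defs.
From mathcomp Require Import all_boot all_order all_algebra.
From mathcomp Require Import sesquilinear complex ring.
From mathcomp Require Import all_classical all_reals all_analysis.

Set Implicit Arguments.
Unset Strict Implicit.
Unset Printing Implicit Defensive.

Import Order.TTheory GRing.Theory Num.Theory.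
Import numFieldNormedType.Exports.

Local Open Scope classical_set_scope.
Local Open Scope ring_scope.

(** * Real and complex scalars *)

Lemma scalar_field_exprn_lt (K : numFieldType) (conj : K -> K) (q e : K) :
  scalar_field conj -> 0 <= q -> q < 1 -> 0 < e -> exists n, q ^+ n < e.
Proof.
have real (R : realType) (x d : R) : 0 <= x -> x < 1 -> 0 < d ->
    exists n, x ^+ n < d.
  move=> x0 x1 d0.
  have /cvgr0Pnorm_lt/(_ d d0)[n _ /(_ n (leqnn n)) /= h] : x ^+ n @[n --> \oo] --> 0.
    by apply: cvg_expr; rewrite ger0_norm.
  by exists n; apply: le_lt_trans h; rewrite ler_norm.
move=> hK; case: hK q e => [R q e|R]; first exact: real.
(* Comparability with [0] makes both imaginary parts vanish, which reduces the complex case to the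
   real one. *)
move=> [a b] [c d]; rewrite !lecE !ltcE /=.
move=> /andP[/eqP b0 a0] /andP[_ a1] /andP[/eqP d0 c0].
have [n hn] := real _ _ _ a0 a1 c0; exists n.
have -> : (a +i* b)%C = (a%:C)%C by rewrite b0.
have -> : (c +i* d)%C = (c%:C)%C by rewrite d0.
by rewrite -rmorphXn /= ltcR.
Qed.

Lemma ler_absorb_half (K : numFieldType) (x y : K) :
  x <= y + 2^-1 * x -> x <= 2 * y.
Proof.
rewrite -lerBlDr; have -> : x - 2^-1 * x = 2^-1 * x by field.
by rewrite ler_pdivrMl.
Qed.

Section Conjugation.
Context (K : numFieldType) (conj : K -> K) (hK : scalar_field conj).

Lemma scalar_norm_conj x : `|conj x| = `|x|.
Proof. by case: hK x => [R|R] x //=; rewrite normcJ. Qed.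

Lemma scalar_conj_ge0 x : 0 <= x -> conj x = x.
Proof.
case: hK x => [R x //|R [a b]]; rewrite lecE /= => /andP[/eqP -> _].
by rewrite oppr0.
Qed.

Lemma scalar_mul_conj x : x * conj x = `|x| ^+ 2.
Proof.
case: hK x => [R|R] x /=; last by rewrite sqr_normc.
by rewrite real_normK ?num_real // expr2.
Qed.

End Conjugation.

(** * Limits and series under a partial order, and fixed points of contractions *)

Lemma cvg_lim_ge0 (K : numFieldType) (u : nat -> K) (l : K) :
  (\forall n \near \oo, 0 <= u n) -> u @ \oo --> l -> 0 <= l.
Proof.
(* Eventually [u n] is its own norm, so by continuity of the norm the limit is its own norm too;
   this works for a partial order on [K]. *)
move=> u0 ul; suff -> : l = `|l| by [].
apply: (cvg_unique _ ul); first exact: norm_hausdorff.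
apply: cvg_trans (cvg_norm ul); apply: near_eq_cvg.
by near=> n; rewrite /= ger0_norm//; near: n.
Unshelve. all: by end_near. Qed.

Lemma ler_cvg_lim (K : numFieldType) (u v : nat -> K) (l m : K) :
  (\forall n \near \oo, u n <= v n) -> u @ \oo --> l -> v @ \oo --> m -> l <= m.
Proof.
move=> uv ul vm; rewrite -subr_ge0.
apply: (@cvg_lim_ge0 _ (v - u)); last exact: cvgB.
by near=> n; rewrite /= subr_ge0; near: n.
Unshelve. all: by end_near. Qed.

Lemma series_le_lim (K : numFieldType) (u : nat -> K) n :
  (forall k, 0 <= u k) -> cvgn (series u) -> series u n <= limn (series u).
Proof.
move=> u0 cu; apply: (@ler_cvg_lim _ (fun=> series u n) (series u)) => //;
  last exact: cvg_cst.
by exists n => // m /= nm; rewrite -subr_ge0 sub_series_geq // sumr_ge0.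
Qed.

Lemma cauchy_cvg_series (K : numFieldType) (V : completeNormedModType K) (u : nat -> V) :
  (forall e, 0 < e -> \forall m \near \oo, forall n,
      (m <= n)%N -> `|\sum_(m <= k < n) u k| < e) -> cvgn (series u).
Proof.
move=> h; apply/cauchy_cvgP/cauchy_seriesP => e e0.
have [N _ hN] := h e e0.
exists ([set m | (N <= m)%N], [set m | (N <= m)%N]) => /=; first by split; exists N.
move=> [m n] /= [Nm Nn]; have [mn|/ltnW nm] := leqP m n; first exact: hN.
by rewrite big_geq // normr0.
Qed.

Lemma cvg_series_tail (K : numFieldType) (V : normedModType K) (u : nat -> V) (e : K) :
  cvgn (series u) -> 0 < e ->
  \forall m \near \oo, forall n, (m <= n)%N -> `|\sum_(m <= k < n) u k| < e.
Proof.
move=> cu e0; have e2 : 0 < e / 2 by rewrite divr_gt0.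
have [N _ hN] := (cvgrPdist_lt (series u) _).1 cu _ e2.
exists N => // m Nm n mn; rewrite -sub_series_geq //.
rewrite (splitr e) -[_ - _](subrKA (limn (series u))) (le_lt_trans (ler_normD _ _)) //.
rewrite ltrD //; last by apply: hN.
by rewrite distrC; apply: hN; exact: leq_trans mn.
Qed.

(** The solution is the Neumann series, the sum of all iterates of [E] at [f]. The iterates decay
    geometrically, so completeness gives convergence. *)
Lemma contraction_solve (K : numFieldType) (conj : K -> K) (H : completeNormedModType K)
    (E : H -> H) (q : K) :
  scalar_field conj -> {morph E : x y / x - y} -> 0 <= q -> q < 1 ->
  (forall x, `|E x| <= q * `|x|) -> forall f, exists h, h = f + E h.
Proof.
move=> hK EB q0 q1 Eq f.
have E0 : E 0 = 0 by have := EB 0 0; rewrite !subrr.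
have ED x y : E (x + y) = E x + E y.
  by rewrite -{1}[y]opprK EB -[- y]add0r EB E0 sub0r opprK.
pose y n := iter n E f.
have yle n : `|y n| <= q ^+ n * `|f|.
  elim: n => [|n IH]; first by rewrite mul1r.
  by rewrite (le_trans (Eq _)) // exprS -mulrA ler_wpM2l.
have geo m n : (m <= n)%N -> \sum_(m <= k < n) q ^+ k <= q ^+ m / (1 - q).
  move=> mn; rewrite ler_pdivlMr ?subr_gt0 //.
  have -> : (\sum_(m <= k < n) q ^+ k) * (1 - q) = q ^+ m - q ^+ n.
    rewrite -[RHS]opprB -(telescope_sumr _ mn) -sumrN mulr_suml.
    by apply: eq_bigr => k _; rewrite exprS; ring.
  by rewrite lerBlDr lerDl exprn_ge0.
have cy : cvgn (series y).
  apply: cauchy_cvg_series => e e0.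
  (* The added 1 keeps the divisor positive when [f = 0]. *)
  have f1 : 0 < `|f| + 1 by rewrite ltr_wpDl.
  have q1' : 0 < 1 - q by rewrite subr_gt0.
  have [N hN] := scalar_field_exprn_lt hK q0 q1
    (divr_gt0 (mulr_gt0 e0 q1') f1).
  exists N => // m /= Nm n mn.
  apply: (@le_lt_trans _ _ (q ^+ N / (1 - q) * (`|f| + 1))).
    apply: le_trans (ler_norm_sum _ _ _) _.
    apply: (@le_trans _ _ (\sum_(m <= k < n) q ^+ k * (`|f| + 1))).
      apply: ler_sum => k _; apply: le_trans (yle k) _.
      by rewrite ler_wpM2l ?exprn_ge0 // lerDl.
    rewrite -mulr_suml ler_wpM2r ?(ltW f1) //; apply: le_trans (geo _ _ mn) _.
    rewrite ler_wpM2r ?invr_ge0 ?(ltW q1') //.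
    by apply: ler_wiXn2l => //; exact: ltW.
  by rewrite mulrAC ltr_pdivrMr // -ltr_pdivlMr.
pose h := limn (series y); exists h.
have yh : series y @ \oo --> h by exact: cy.
(* This recurrence of the partial sums becomes the fixed-point equation in the limit. *)
have yS n : series y n.+1 = f + E (series y n).
  elim: n => [|n IH]; first by rewrite /series /= big_nat1 big_geq // E0 addr0.
  by rewrite [LHS]seriesSr [in LHS]IH [in RHS]seriesSr ED addrA.
apply: (cvg_unique _ (F := series y n.+1 @[n --> \oo])); first exact: norm_hausdorff.
  by move: yh; rewrite -cvg_shiftS.
rewrite (_ : (fun n => series y n.+1) = (fun n => f + E (series y n))); last first.
  by apply/funext => n; exact: yS.
apply: cvgD; first exact: cvg_cst.
apply/cvgrPdist_lt => e e0; have [N _ hN] := (cvgrPdist_lt _ _).1 yh _ e0.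
exists N => // n /hN /= hn; rewrite -EB; apply: le_lt_trans (Eq _) _.
by apply: le_lt_trans hn; rewrite ler_piMl // ltW.
Qed.

(** * Inner product: Cauchy-Schwarz and continuity *)

Section Hilbert.
Context (K : numFieldType) (conj : K -> K) (hK : scalar_field conj).
Context (H : completeNormedModType K) (ip : {dot H for conj}).
Context (hip : norm_of_ip ip).

Lemma ip_conj f g : ip f g = conj (ip g f).
Proof. by rewrite hermitian_subproof expr0 mul1r. Qed.

Lemma norm_ipC f g : `|ip f g| = `|ip g f|.
Proof. by rewrite ip_conj scalar_norm_conj. Qed.

Lemma ip_0l f : ip 0 f = 0.
Proof. exact: linear0l. Qed.

Lemma ip_0r f : ip f 0 = 0.
Proof. exact: linear0r. Qed.

Lemma ip_subl f g h : ip (f - g) h = ip f h - ip g h.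
Proof. exact: linearBl. Qed.

Lemma ip_subr f g h : ip f (g - h) = ip f g - ip f h.
Proof. exact: linearBr. Qed.

Lemma ip_scalel a f g : ip (a *: f) g = a * ip f g.
Proof. by rewrite linearZl_LR. Qed.

Lemma ip_scaler a f g : ip f (a *: g) = conj a * ip f g.
Proof. by rewrite linearZr_LR. Qed.

Lemma ip_suml I (r : seq I) (P : pred I) (c : I -> K) (u : I -> H) v :
  ip (\sum_(i <- r | P i) c i *: u i) v = \sum_(i <- r | P i) c i * ip (u i) v.
Proof.
rewrite (big_morph (ip^~ v) (id1 := 0) (op1 := +%R)); last 2 first.
- by move=> x y; rewrite linearDl.
- by rewrite ip_0l.
by apply: eq_bigr => i _; rewrite linearZl_LR.
Qed.

Lemma ip_sumr I (r : seq I) (P : pred I) (c : I -> K) (u : I -> H) v :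
  ip v (\sum_(i <- r | P i) c i *: u i) = \sum_(i <- r | P i) conj (c i) * ip v (u i).
Proof.
rewrite (big_morph (ip v) (id1 := 0) (op1 := +%R)); last 2 first.
- by move=> x y; rewrite linearDr.
- by rewrite ip_0r.
by apply: eq_bigr => i _; rewrite ip_scaler.
Qed.

Lemma cauchy_schwarz f g : `|ip f g| <= `|f| * `|g|.
Proof.
have [->|g0] := eqVneq g 0; first by rewrite ip_0r !normr0 mulr0.
have G0 : 0 < `|g| ^+ 2 by rewrite exprn_gt0 // normr_gt0.
rewrite -(@ler_pXn2r _ 2) ?nnegrE ?mulr_ge0 // exprMn.
(* Up to the factor [|g|^2], [w] is the component of [f] orthogonal to [g]; the inequality is
   [0 <= ip w w] expanded. *)
set w := `|g| ^+ 2 *: f - ip f g *: g.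
have wg : ip w g = 0 by rewrite /w ip_subl !ip_scalel hip mulrC subrr.
have : 0 <= ip w w by rewrite -hip exprn_ge0.
rewrite {2}/w ip_subr !ip_scaler wg mulr0 subr0.
rewrite (scalar_conj_ge0 hK) ?exprn_ge0 // pmulr_rge0 //.
rewrite /w ip_subl !ip_scalel (ip_conj g f) (scalar_mul_conj hK) -hip subr_ge0.
by rewrite mulrC.
Qed.

Lemma cvg_ipl (u : nat -> H) l g : u @ \oo --> l -> ip (u n) g @[n --> \oo] --> ip l g.
Proof.
move=> ul; apply/cvgrPdist_lt => e e0.
have g1 : 0 < `|g| + 1 by rewrite ltr_wpDl.
have [N _ hN] := (cvgrPdist_lt _ _).1 ul _ (divr_gt0 e0 g1).
exists N => // n /hN /=; rewrite ltr_pdivlMr // => h.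
rewrite -ip_subl; apply: le_lt_trans (cauchy_schwarz _ _) (le_lt_trans _ h).
by rewrite ler_wpM2l // lerDl.
Qed.

Lemma cvg_ipr (u : nat -> H) l g : u @ \oo --> l -> ip g (u n) @[n --> \oo] --> ip g l.
Proof.
move=> ul; apply/cvgrPdist_lt => e e0.
have [N _ hN] := (cvgrPdist_lt _ _).1 (cvg_ipl (g := g) ul) _ e0.
by exists N => // n /hN /=; rewrite -ip_subr norm_ipC ip_subl.
Qed.

(** * Bessel sequences and convergence of synthesis *)

Lemma real_amgm (M a b : K) : 0 < M -> a \is Num.real -> b \is Num.real ->
  a * b *+ 2 <= M * a ^+ 2 + M^-1 * b ^+ 2.
Proof.
move=> M0 ar br; rewrite -subr_ge0.
have -> : M * a ^+ 2 + M^-1 * b ^+ 2 - a * b *+ 2 = M^-1 * (M * a - b) ^+ 2.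
  by field; rewrite gt_eqF.
rewrite mulr_ge0 ?invr_ge0 ?(ltW M0) // real_exprn_even_ge0 //.
by rewrite realB // realM // gtr0_real.
Qed.

(** Let [v] be the sum. Expanding [ip v v] and applying the weighted inequality [real_amgm] termwise
    bounds [2 |v|^2] by the right side plus [M^-1] times a partial energy of [v]. The Bessel bound
    at [v] itself makes this last term at most [|v|^2], which cancels. *)
Lemma bessel_norm_sum M (Phi : nat -> H) (c : nat -> K) m n :
  bessel_bound ip M Phi ->
  `|\sum_(m <= k < n) c k *: Phi k| ^+ 2 <= M * \sum_(m <= k < n) `|c k| ^+ 2.
Proof.
case=> M0 B; set v := \sum_(m <= k < n) _.
have Bv : \sum_(m <= k < n) `|ip v (Phi k)| ^+ 2 <= M * `|v| ^+ 2.
  have [cv lv] := B v; apply: le_trans lv.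
  apply: le_trans (series_le_lim n _ cv); last by move=> k; rewrite exprn_ge0.
  have [mn|/ltnW nm] := leqP m n; last first.
    by rewrite big_geq // sumr_ge0 // => k _; rewrite exprn_ge0.
  by rewrite -sub_series_geq // lerBlDr lerDl sumr_ge0 // => k _; rewrite exprn_ge0.
have vle : `|v| ^+ 2 <= \sum_(m <= k < n) `|c k| * `|ip v (Phi k)|.
  rewrite -[`|v| ^+ 2]ger0_norm ?exprn_ge0 // hip {1}/v ip_suml.
  apply: le_trans (ler_norm_sum _ _ _) _.
  by apply: ler_sum => k _; rewrite normrM norm_ipC.
rewrite -(lerD2r (`|v| ^+ 2)) -mulr2n.
apply: (@le_trans _ _ ((\sum_(m <= k < n) `|c k| * `|ip v (Phi k)|) *+ 2)).
  by rewrite lerMn2r.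
apply: (@le_trans _ _ (\sum_(m <= k < n)
    (M * `|c k| ^+ 2 + M^-1 * `|ip v (Phi k)| ^+ 2))).
  by rewrite -sumrMnl; apply: ler_sum => k _; apply: real_amgm.
by rewrite big_split /= -!mulr_sumr lerD2l ler_pdivrMl.
Qed.

(** [bessel_norm_sum] on blocks far out gives the Cauchy property; on initial blocks it gives the
    norm bound in the limit. *)
Lemma bessel_cvg_synthesis M (Phi : nat -> H) (c : nat -> K) :
  bessel_bound ip M Phi -> cvgn (series (fun n => `|c n| ^+ 2)) ->
  cvgn (series (fun n => c n *: Phi n)) /\
  `|synthesis Phi c| ^+ 2 <= M * limn (series (fun n => `|c n| ^+ 2)).
Proof.
move=> B cc; have M0 : 0 < M by case: B.
have cs : cvgn (series (fun n => c n *: Phi n)).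
  apply: cauchy_cvg_series => e e0.
  have e2 : 0 < e ^+ 2 / M by rewrite divr_gt0 // exprn_gt0.
  have [N _ hN] := cvg_series_tail cc e2.
  exists N => // m /= Nm n mn; have := hN m Nm n mn.
  rewrite ger0_norm ?sumr_ge0 //.
  rewrite ltr_pdivlMr // mulrC => h.
  rewrite -(@ltr_pXn2r _ 2) ?nnegrE ?(ltW e0) //.
  apply: le_lt_trans h; exact: bessel_norm_sum.
split=> //; set u := series (fun n => c n *: Phi n) in cs *.
apply: (@ler_cvg_lim _ (fun n => `|u n| * `|u n|)
  (fun=> M * limn (series (fun n => `|c n| ^+ 2)))).
- exists 0%N => // n _ /=; rewrite -expr2.
  apply: le_trans (bessel_norm_sum _ _ _ B) _.
  rewrite ler_pM2l //; apply: (series_le_lim n _ cc) => k; exact: exprn_ge0.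
- by rewrite expr2; apply: cvgM; apply: cvg_norm.
- exact: cvg_cst.
Qed.

(** * The composites [T_Phi U_Theta] and their adjoints *)

Section Mixed.
Context (M N : K) (Phi Theta : nat -> H).
Context (BPhi : bessel_bound ip M Phi) (BTheta : bessel_bound ip N Theta).

Lemma cvg_synthesis_analysis f :
  series (fun n => analysis ip Theta f n *: Phi n) @ \oo -->
  synthesis Phi (analysis ip Theta f).
Proof. by case: (bessel_cvg_synthesis BPhi (BTheta.2 f).1). Qed.

Lemma synthesis_analysis_le f :
  `|synthesis Phi (analysis ip Theta f)| ^+ 2 <= M * N * `|f| ^+ 2.
Proof.
have [cf lf] := BTheta.2 f; have [_ h] := bessel_cvg_synthesis BPhi cf.
by apply: le_trans h _; rewrite -mulrA ler_pM2l //; case: BPhi.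
Qed.

Lemma synthesis_analysisB :
  {morph (fun f => synthesis Phi (analysis ip Theta f)) : f g / f - g}.
Proof.
move=> f g /=; apply: (cvg_unique _ (cvg_synthesis_analysis (f := f - g))).
  exact: norm_hausdorff.
rewrite (_ : (fun n => _) = (fun n => analysis ip Theta f n *: Phi n)
   - (fun n => analysis ip Theta g n *: Phi n)); last first.
  by apply/funext => n; rewrite /analysis ip_subl scalerBl.
by rewrite seriesD seriesN; apply: cvgB; exact: cvg_synthesis_analysis.
Qed.

End Mixed.

(** Both sides are limits of the same partial sums, with terms [ip f (Theta k) * ip (Phi k) g]. *)
Lemma synthesis_analysis_adj M N (Phi Theta : nat -> H) f g :
  bessel_bound ip M Phi -> bessel_bound ip N Theta ->
  ip (synthesis Phi (analysis ip Theta f)) g =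
  ip f (synthesis Theta (analysis ip Phi g)).
Proof.
move=> BP BT.
apply: (cvg_unique _ (cvg_ipl (g := g) (cvg_synthesis_analysis BP BT (f := f)))).
  exact: norm_hausdorff.
have := cvg_ipr (g := f) (cvg_synthesis_analysis BT BP (f := g)).
apply: cvg_trans; apply: near_eq_cvg; exists 0%N => // n _ /=.
rewrite /series /= ip_suml ip_sumr; apply: eq_bigr => k _.
by rewrite /analysis -ip_conj mulrC.
Qed.

(** * Surjectivity of the adjoint of a map bounded below *)

Lemma sqr_norm_ler (x y : H) q : 0 <= q ->
  `|x| ^+ 2 <= q ^+ 2 * `|y| ^+ 2 -> `|x| <= q * `|y|.
Proof. by move=> q0; rewrite -exprMn ler_pXn2r ?nnegrE ?mulr_ge0. Qed.

(* [S T] is positive, as [S] is the adjoint of [T], and coercive, so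
   [1 - S T / s] is a contraction. *)
Lemma surjective_of_adjoint (S T : H -> H) (s c : K) :
  {morph S : x y / x - y} -> {morph T : x y / x - y} ->
  (forall y z, ip (S y) z = ip y (T z)) ->
  0 < s -> (forall y, `|S y| ^+ 2 <= s * `|y| ^+ 2) ->
  0 < c -> (forall z, `|z| ^+ 2 <= c * `|T z| ^+ 2) ->
  forall y, exists z, S (T z) = y.
Proof.
move=> SB TB adj s0 Ss c0 Tc y.
(* Coercivity gives the contraction defect [(s * c)^-1]; the smaller [d] is also below 1, which
   makes [q] nonnegative. *)
pose d := (1 + s * c)^-1.
have sc0 : 0 < s * c by rewrite mulr_gt0.
have d1 : d < 1 by rewrite invf_lt1 ?ltrDl // addr_gt0.
have d0 : 0 < d by rewrite invr_gt0 addr_gt0.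
(* Chosen so that [q ^+ 2 >= 1 - d], which replaces a square root. *)
pose q := 1 - d / 2.
have d2 : 0 < d / 2 by rewrite divr_gt0.
have q1 : q < 1 by rewrite ltrBlDr ltrDl.
have q0 : 0 <= q.
  rewrite subr_ge0 ler_pdivrMr // mul1r (le_trans (ltW d1)) //.
  by rewrite ler1n.
pose E z := z - s^-1 *: S (T z).
have EB : {morph E : x y / x - y}.
  by move=> u v; rewrite /E TB SB scalerBr !opprB addrACA [- v + _]addrC -addrACA.
have Eq z : `|E z| <= q * `|z|.
  apply: sqr_norm_ler => //.
  have STz : ip (S (T z)) z = `|T z| ^+ 2 by rewrite adj -hip.
  have zST : ip z (S (T z)) = `|T z| ^+ 2.
    by rewrite ip_conj STz (scalar_conj_ge0 hK) ?exprn_ge0.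
  have si : conj s^-1 = s^-1 by rewrite (scalar_conj_ge0 hK) // invr_ge0 ltW.
  have -> : `|E z| ^+ 2 = `|z| ^+ 2 - s^-1 * `|T z| ^+ 2 *+ 2
      + s^-1 ^+ 2 * `|S (T z)| ^+ 2.
    rewrite !hip /E !(ip_subl, ip_subr) !(ip_scalel, ip_scaler) STz zST si -!hip.
    by ring.
  (* The bound [s] on [S] lets one of the two negative terms absorb the quadratic one. *)
  apply: (@le_trans _ _ (`|z| ^+ 2 - s^-1 * `|T z| ^+ 2)).
    rewrite mulr2n opprD addrA -[leRHS]addr0 -[leLHS]addrA lerD2l addrC subr_le0.
    by rewrite expr2 -mulrA ler_pM2l ?invr_gt0 // ler_pdivrMl.
  apply: (@le_trans _ _ ((1 - d) * `|z| ^+ 2)).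
    rewrite mulrBl mul1r lerD2l lerN2.
    apply: (@le_trans _ _ ((s * c)^-1 * `|z| ^+ 2)).
      rewrite ler_wpM2r ?exprn_ge0 // lef_pV2 ?posrE ?addr_gt0 //.
      by rewrite lerDr.
    by rewrite invfM -mulrA ler_pM2l ?invr_gt0 // ler_pdivrMl.
  rewrite ler_wpM2r ?exprn_ge0 //.
  have -> : q ^+ 2 = 1 - d + (d / 2) ^+ 2 by rewrite /q; field.
  by rewrite lerDl exprn_ge0 // ltW.
have [z zE] := contraction_solve hK EB q0 q1 Eq (s^-1 *: y).
exists z; apply: (scalerI (a := s^-1)); first by rewrite invr_neq0 // gt_eqF.
by rewrite -[RHS](addrK (E z)) -zE /E opprB addrC subrK.
Qed.

End Hilbert.

Theorem theorem2p10
  (K : numFieldType) (conj : K -> K) (hK : scalar_field conj)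
  (H : completeNormedModType K) (ip : {dot H for conj})
  (hip : norm_of_ip ip) (hsep : separable_space H)
  (Phi Phigd : nat -> H) (A Ainv : {linear H -> H})
  (hPhi : frame ip Phi)
  (hPhigd : gdual ip Phi Phigd A)
  (hA : inverse_op A Ainv) :
  exists delta C : K,
    [/\ 0 < delta, 0 < C &
      forall (Psi : nat -> H) (M : K),
        frame ip Psi ->
        bessel_bound ip M (Phi \- Psi) ->
        M < delta ->
        exists Psigd : nat -> H,
          [/\ gdual ip Psi Psigd A,
              bessel_bound ip (C * M) (Phigd \- Psigd),
              forall f : H, synthesis Phi (analysis ip Phigd f) = Ainv f &
              forall f : H, synthesis Psi (analysis ip Psigd f) = Ainv f]].
Proof.
case: hPhi => _ [Mp [_ BPhi _]].
case: hPhigd => -[mg [Mg [mg0 Bgd gdlb]]] Ainvertible gdE.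
case: hA => -[a0 A_le0] _ AK AinvK.
have Mg0 : 0 < Mg by case: Bgd.
(* [a0] may be zero, and even negative or non-real if [H] is trivial; [a] is a positive bound for
   [A]. *)
pose a := `|a0| + 1.
have agt0 : 0 < a by rewrite ltr_wpDl.
have A_le f : `|A f| <= a * `|f|.
  apply: le_trans (_ : `|a0| * `|f| <= _); last by rewrite ler_wpM2r // lerDl.
  rewrite -[`|f|]normr_id -normrM ger0_norm //.
  by apply: le_trans (A_le0 f).
have PhiE f : synthesis Phi (analysis ip Phigd f) = Ainv f.
  apply: (cvg_unique _ (cvg_synthesis_analysis hK hip BPhi Bgd (f := f))).
    exact: norm_hausdorff.
  by have := gdE (Ainv f); rewrite AinvK.
(* The first constant gives [a ^+ 2 * M * Mg < 1/4], so [A D] contracts by [1/2]. The second is [Mg]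
   from the Bessel bound of [Phigd], times [a ^+ 2 * Mg] from [AD2], times 4 from
   [|X f| <= 2 |f|]. *)
exists (4 * a ^+ 2 * Mg)^-1, (4 * a ^+ 2 * Mg ^+ 2).
split=> [||Psi M [mq [Mq [_ BPsi _]]] BD Mdelta].
- by rewrite invr_gt0 !mulr_gt0 ?exprn_gt0.
- by rewrite !mulr_gt0 ?exprn_gt0.
have M0 : 0 < M by case: BD.
have Mq0 : 0 < Mq by case: BPsi.
pose T f := synthesis Psi (analysis ip Phigd f).
pose D f := synthesis (Phi \- Psi) (analysis ip Phigd f).
pose S f := synthesis Phigd (analysis ip Psi f).
pose S0 f := synthesis Phigd (analysis ip Phi f).
have TD f : T f = Ainv f - D f.
  rewrite -PhiE; apply: (cvg_unique _ (cvg_synthesis_analysis hK hip BPsi Bgd (f := f))).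
    exact: norm_hausdorff.
  rewrite (_ : (fun n => _) = (fun n => analysis ip Phigd f n *: Phi n)
     - (fun n => analysis ip Phigd f n *: (Phi \- Psi) n)); last first.
    by apply/funext => n /=; rewrite -[RHS]scalerBr subKr.
  rewrite seriesD seriesN; apply: cvgB.
    exact: (cvg_synthesis_analysis hK hip BPhi Bgd).
  exact: (cvg_synthesis_analysis hK hip BD Bgd).
have DB : {morph D : x y / x - y} by exact: (synthesis_analysisB hK hip BD Bgd).
have TB : {morph T : x y / x - y} by exact: (synthesis_analysisB hK hip BPsi Bgd).
have SB : {morph S : x y / x - y} by exact: (synthesis_analysisB hK hip Bgd BPsi).
have AD2 f : `|A (D f)| ^+ 2 <= a ^+ 2 * (M * Mg) * `|f| ^+ 2.
  apply: (@le_trans _ _ (a ^+ 2 * `|D f| ^+ 2)).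
    by rewrite -exprMn ler_pXn2r ?nnegrE ?mulr_ge0 // ltW.
  rewrite -mulrA ler_pM2l ?exprn_gt0 //.
  exact: (synthesis_analysis_le hK hip BD Bgd).
have AD f : `|A (D f)| <= 2^-1 * `|f|.
  apply: sqr_norm_ler => //; apply: le_trans (AD2 f) _.
  rewrite ler_wpM2r ?exprn_ge0 //.
  have -> : (2^-1 : K) ^+ 2 = a ^+ 2 * ((4 * a ^+ 2 * Mg)^-1 * Mg).
    by field; rewrite !gt_eqF.
  by rewrite ler_pM2l ?exprn_gt0 // ler_pM2r // ltW.
have half0 : 0 <= 2^-1 :> K by rewrite invr_ge0.
have half1 : 2^-1 < 1 :> K by rewrite invf_lt1 // ltr1n.
have [X XE] : {X : H -> H & forall f, X f = f + A (D (X f))}.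
  have h := contraction_solve hK (E := A \o D) (q := 2^-1) _ half0 half1 AD.
  apply: (@choice _ _ (fun f h => h = f + A (D h))); apply: h => x y /=.
  by rewrite DB linearB.
have TX f : T (X f) = Ainv f.
  by rewrite TD {1}XE linearD AK addrK.
(* This and [X_ge] carry the upper and lower frame bounds of [Phigd] over to [Psigd]. *)
have X_le f : `|X f| <= 2 * `|f|.
  apply: ler_absorb_half; rewrite {1}XE; apply: le_trans (ler_normD _ _) _.
  by rewrite lerD2l.
have X_ge f : `|f| <= 2 * `|X f|.
  have {1}-> : f = X f - A (D (X f)) by rewrite {1}XE addrK.
  apply: le_trans (ler_normB _ _) _; rewrite mulrDl mul1r lerD2l.
  by apply: le_trans (AD _) _; rewrite ler_piMl // ltW.
(* In [z = A (T z) + A (D z)] the last term has norm at most [|z| / 2] and is absorbed. *)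
have Tge z : `|z| ^+ 2 <= (2 * a) ^+ 2 * `|T z| ^+ 2.
  rewrite -exprMn ler_pXn2r ?nnegrE ?mulr_ge0 ?(ltW agt0) // -mulrA.
  apply: ler_absorb_half; have {1}-> : z = A (T z) + A (D z).
    by rewrite -linearD TD subrK AinvK.
  by apply: le_trans (ler_normD _ _) _; apply: lerD.
have Sadj y z : ip (S y) z = ip y (T z).
  exact: (synthesis_analysis_adj hK hip _ _ Bgd BPsi).
have [Y YE] : {Y : nat -> H & forall n, S (Y n) = Phigd n}.
  apply: (@choice _ _ (fun n y => S y = Phigd n)) => n.
  have [z zE] := surjective_of_adjoint hK hip SB TB Sadj (mulr_gt0 Mg0 Mq0)
    (synthesis_analysis_le hK hip Bgd BPsi) (exprn_gt0 2 (mulr_gt0 (ltr0n _ 2) agt0))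
    Tge (Phigd n).
  by exists (T z).
pose Psigd n := S0 (Y n).
(* Both sides equal [ip (Ainv f) (Y n)]: the left by the adjoint of [S0], the right by that of [S]
   and [T (X f) = Ainv f]. *)
have gdX f n : ip f (Psigd n) = ip (X f) (Phigd n).
  rewrite -YE [RHS]ip_conj Sadj -ip_conj TX -PhiE.
  by rewrite (synthesis_analysis_adj hK hip _ _ BPhi Bgd).
have energyX f : energy ip Psigd f = energy ip Phigd (X f).
  by rewrite /energy; congr series; apply/funext => n; rewrite gdX.
have energyB f : energy ip (Phigd \- Psigd) f = energy ip Phigd (f - X f).
  by rewrite /energy; congr series; apply/funext => n; rewrite ip_subr gdX ip_subl.
have synthE f : synthesis Psi (analysis ip Psigd f) = Ainv f.
  rewrite -TX /T; congr synthesis; apply/funext => n; exact: gdX.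
exists Psigd; split => //.
- split => //; last first.
    (* By [gdX] the series sums to [T (X (A f)) = Ainv (A f) = f]. *)
    move=> f; rewrite (_ : (fun n => _) =
      (fun n => analysis ip Phigd (X (A f)) n *: Psi n)).
      by rewrite -[X in _ --> X]AK -TX; exact: (cvg_synthesis_analysis hK hip BPsi Bgd).
    by apply/funext => n; rewrite gdX.
  (* The factors 4 are the squares of the 2 in [X_ge] and [X_le]. *)
  exists (mg / 4), (Mg * 4); split.
  + by rewrite divr_gt0.
  + split=> [|f]; first by rewrite mulr_gt0.
    rewrite energyX; have [? h] := Bgd.2 (X f); split => //.
    apply: le_trans h _; rewrite -mulrA ler_pM2l //.
    by rewrite (_ : 4 = 2 ^+ 2 :> K) -?exprMn ?ler_pXn2r ?nnegrE ?mulr_ge0 // -natrX.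
  + move=> f; rewrite energyX; apply: le_trans (gdlb (X f)).
    rewrite -mulrA ler_pM2l // ler_pdivrMl //.
    by rewrite (_ : 4 = 2 ^+ 2 :> K) -?exprMn ?ler_pXn2r ?nnegrE ?mulr_ge0 // -natrX.
- split=> [|f]; first by rewrite !mulr_gt0 ?exprn_gt0.
  rewrite energyB; have [? h] := Bgd.2 (f - X f); split => //.
  apply: le_trans h _.
  rewrite (_ : 4 * _ * _ * M * _ = Mg * (a ^+ 2 * (M * Mg) * ((2 * `|f|) ^+ 2)));
    last by ring.
  rewrite ler_pM2l // {1}XE opprD addrA subrr add0r normrN.
  apply: le_trans (AD2 _) _.
  by rewrite ler_pM2l ?mulr_gt0 ?exprn_gt0 // ler_pXn2r ?nnegrE ?mulr_ge0.
Qed.
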